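(* Let $\mathcal{E}$ be a locally Cartesian closed category, let $(\mathbb{T},+,0)$ be a monoid in $\mathcal{E}$, and let $p$ be a polynomial in $\mathcal{E}$. Open dynamical systems over $p$ with time $\mathbb{T}$ are the objects of a category $\mathbf{Coalg}^{\mathbb{T}}(p)$, defined as follows. A morphism $f:(X,\vartheta^o,\vartheta^u)\to(Y,\psi^o,\psi^u)$ is a morphism $f:X\to Y$ in $\mathcal{E}$ such that, for every time $t:\mathbb{T}$ and every global section $\sigma$ of $p$, $$ f\circ\vartheta^u(t)\circ\vartheta^o(t)^*\sigma \;=\; \psi^u(t)\circ\psi^o(t)^*\sigma\circ f \;:\; X\to Y .$$ The identity morphism on $(X,\vartheta^o,\vartheta^u)$ is $\mathrm{id}_X$, and composition of morphisms is composition in $\mathcal{E}$ of the underlying maps of state spaces.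
   Context: $\mathcal{E}$ is thought of as concrete (e.g. $\mathbf{Set}$), and element notation is used. A polynomial in $\mathcal{E}$ is a coproduct of representables $p=\sum_{i:p(1)}y^{p[i]}$, where $y^A=\mathcal{E}(A,-)$; equivalently it is a bundle $\sum_{i:p(1)}p[i]\to p(1)$ in $\mathcal{E}$ with fibres $p[i]$. A (global) section of $p$ is a section $\sigma:p(1)\to\sum_{i:p(1)}p[i]$ of this bundle. A closed dynamical system on $S:\mathcal{E}$ with time $\mathbb{T}$ is an action of $\mathbb{T}$ on $S$, i.e. maps $\vartheta(t):S\to S$ with $\vartheta(0)=\mathrm{id}_S$ and $\vartheta(s+t)=\vartheta(s)\circ\vartheta(t)$. A (deterministic) open dynamical system over $p$ with state space $S$ and time $\mathbb{T}$ is a triple $\vartheta=(S,\vartheta^o,\vartheta^u)$ with $\vartheta^o:\mathbb{T}\times S\to p(1)$ (output map) and $\vartheta^u:\sum_{t:\mathbb{T}}\sum_{s:S}p[\vartheta^o(t,s)]\to S$ (update map), such that for every section $\sigma$ of $p$ the closure $$\vartheta^\sigma(t):=\Big(S\xrightarrow{\vartheta^o(t)^*\sigma}\sum_{s:S}p[\vartheta^o(t,s)]\xrightarrow{\vartheta^u(t)}S\Big)$$ is a closed dynamical system on $S$. Here $\vartheta^o(t)^*\sigma$ is the pullback of $\sigma$ along $\vartheta^o(t):S\to p(1)$, i.e. $s\mapsto(s,\sigma(\vartheta^o(t,s)))$. *)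

(* Defs.v *)
From Stdlib Require Import ProofIrrelevance.

Set Implicit Arguments.
Unset Strict Implicit.
Unset Printing Implicit Defensive.

(** * Categories *)

Record category_on (Ob : Type) (Hom : Ob -> Ob -> Type) := CategoryOn {
  idm : forall A : Ob, Hom A A;
  compm : forall A B C : Ob, Hom B C -> Hom A B -> Hom A C;
  comp1m : forall (A B : Ob) (f : Hom A B), compm (idm B) f = f;
  compm1 : forall (A B : Ob) (f : Hom A B), compm f (idm A) = f;
  compmA : forall (A B C D : Ob) (h : Hom C D) (g : Hom B C) (f : Hom A B),
    compm h (compm g f) = compm (compm h g) f
}.

Record category := Category {
  Ob :> Type;
  Hom : Ob -> Ob -> Type;
  cat_on : category_on Hom
}.

Definition idC (C : category) (A : C) : Hom A A := idm (cat_on C) A.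
Definition compC (C : category) (A B D : C) (g : Hom B D) (f : Hom A B) :
  Hom A D := compm (cat_on C) g f.

Notation "g ∘ f" := (compC g f) (at level 40, left associativity).

Lemma idCl (C : category) (A B : C) (f : Hom A B) : idC B ∘ f = f.
Proof. exact (comp1m (cat_on C) f). Qed.

Lemma idCr (C : category) (A B : C) (f : Hom A B) : f ∘ idC A = f.
Proof. exact (compm1 (cat_on C) f). Qed.

Lemma compCA (C : category) (A B D F : C)
  (h : Hom D F) (g : Hom B D) (f : Hom A B) : h ∘ (g ∘ f) = h ∘ g ∘ f.
Proof. exact (compmA (cat_on C) h g f). Qed.

(** * Cartesian closed categories *)

Record terminal (C : category) := Terminal {
  tobj : C;
  tmap : forall A : C, Hom A tobj;
  tmap_unique : forall (A : C) (f : Hom A tobj), f = tmap A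
}.

Record products (C : category) := Products {
  prod_obj : C -> C -> C;
  pr1 : forall A B : C, Hom (prod_obj A B) A;
  pr2 : forall A B : C, Hom (prod_obj A B) B;
  pairing : forall X A B : C, Hom X A -> Hom X B -> Hom X (prod_obj A B);
  pr1_pairing : forall (X A B : C) (f : Hom X A) (g : Hom X B),
    pr1 A B ∘ pairing f g = f;
  pr2_pairing : forall (X A B : C) (f : Hom X A) (g : Hom X B),
    pr2 A B ∘ pairing f g = g;
  pairing_unique : forall (X A B : C) (h k : Hom X (prod_obj A B)),
    pr1 A B ∘ h = pr1 A B ∘ k -> pr2 A B ∘ h = pr2 A B ∘ k -> h = k
}.

Definition prod_map (C : category) (P : products C) (A B A' B' : C)
  (f : Hom A A') (g : Hom B B') : Hom (prod_obj P A B) (prod_obj P A' B') :=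
  pairing P (f ∘ pr1 P A B) (g ∘ pr2 P A B).

Record exponentials (C : category) (P : products C) := Exponentials {
  exp_obj : C -> C -> C;
  ev : forall A B : C, Hom (prod_obj P (exp_obj A B) A) B;
  curry : forall X A B : C, Hom (prod_obj P X A) B -> Hom X (exp_obj A B);
  ev_curry : forall (X A B : C) (f : Hom (prod_obj P X A) B),
    ev A B ∘ prod_map P (curry f) (idC A) = f;
  curry_unique : forall (X A B : C) (g : Hom X (exp_obj A B)),
    curry (ev A B ∘ prod_map P g (idC A)) = g
}.

Record cartesian_closed (C : category) := CartesianClosed {
  cc_terminal : terminal C;
  cc_products : products C;
  cc_exponentials : exponentials cc_products
}.

(** * Slices and local cartesian closure *)

Record slice_obj (C : category) (I : C) := SliceObj {
  sdom : C;
  smap : Hom sdom I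
}.

Record slice_hom (C : category) (I : C) (x y : slice_obj I) := SliceHom {
  shom : Hom (sdom x) (sdom y);
  shomP : smap y ∘ shom = smap x
}.

Lemma slice_hom_eq (C : category) (I : C) (x y : slice_obj I)
  (f g : slice_hom x y) : shom f = shom g -> f = g.
Proof.
destruct f as [f fP], g as [g gP]; simpl; intros e; subst g.
now rewrite (proof_irrelevance _ fP gP).
Qed.

Lemma slice_idP (C : category) (I : C) (x : slice_obj I) :
  smap x ∘ idC (sdom x) = smap x.
Proof. apply idCr. Qed.

Lemma slice_compP (C : category) (I : C) (x y z : slice_obj I)
  (g : slice_hom y z) (f : slice_hom x y) :
  smap z ∘ (shom g ∘ shom f) = smap x.
Proof. now rewrite compCA, (shomP g), (shomP f). Qed.

Definition slice_id (C : category) (I : C) (x : slice_obj I) : slice_hom x x :=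
  SliceHom (slice_idP x).

Definition slice_comp (C : category) (I : C) (x y z : slice_obj I)
  (g : slice_hom y z) (f : slice_hom x y) : slice_hom x z :=
  SliceHom (slice_compP g f).

Definition slice_category_on (C : category) (I : C) :
  category_on (@slice_hom C I).
Proof.
refine (@CategoryOn _ _ (@slice_id C I) (@slice_comp C I) _ _ _);
  intros; apply slice_hom_eq; simpl.
- apply idCl.
- apply idCr.
- apply compCA.
Defined.

Definition slice (C : category) (I : C) : category :=
  Category (slice_category_on I).

Record lccc := LCCC {
  lcat :> category;
  lterminal : terminal lcat;
  lslice : forall I : lcat, cartesian_closed (slice I)
}.

(** Pullbacks are the binary products of the slices; binary products are the
    pullbacks over the terminal object. *)

Definition pb_slice (E : lccc) (A B I : E) (f : Hom A I) (g : Hom B I) :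
  slice I := prod_obj (cc_products (lslice I)) (SliceObj f) (SliceObj g).

Definition pb (E : lccc) (A B I : E) (f : Hom A I) (g : Hom B I) : E :=
  sdom (pb_slice f g).

Definition pb1 (E : lccc) (A B I : E) (f : Hom A I) (g : Hom B I) :
  Hom (pb f g) A :=
  shom (pr1 (cc_products (lslice I)) (SliceObj f) (SliceObj g)).

Definition pb2 (E : lccc) (A B I : E) (f : Hom A I) (g : Hom B I) :
  Hom (pb f g) B :=
  shom (pr2 (cc_products (lslice I)) (SliceObj f) (SliceObj g)).

Lemma pb_comm (E : lccc) (A B I : E) (f : Hom A I) (g : Hom B I) :
  f ∘ pb1 f g = g ∘ pb2 f g.
Proof.
transitivity (smap (pb_slice f g)).
- exact (shomP (pr1 (cc_products (lslice I)) (SliceObj f) (SliceObj g))).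
- symmetry.
  exact (shomP (pr2 (cc_products (lslice I)) (SliceObj f) (SliceObj g))).
Qed.

Definition pb_pair (E : lccc) (X A B I : E) (f : Hom A I) (g : Hom B I)
  (h : Hom X A) (k : Hom X B) (e : f ∘ h = g ∘ k) : Hom X (pb f g) :=
  let x : slice_obj I := SliceObj (f ∘ h) in
  shom (@pairing _ (cc_products (lslice I)) x (SliceObj f) (SliceObj g)
          (@SliceHom _ _ x (SliceObj f) h eq_refl)
          (@SliceHom _ _ x (SliceObj g) k (eq_sym e))).

Lemma pb1_pair (E : lccc) (X A B I : E) (f : Hom A I) (g : Hom B I)
  (h : Hom X A) (k : Hom X B) (e : f ∘ h = g ∘ k) :
  pb1 f g ∘ pb_pair e = h.
Proof.
exact (f_equal (fun u => shom u)
  (@pr1_pairing _ (cc_products (lslice I)) (SliceObj (f ∘ h)) _ _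
     (@SliceHom _ _ (SliceObj (f ∘ h)) (SliceObj f) h eq_refl)
     (@SliceHom _ _ (SliceObj (f ∘ h)) (SliceObj g) k (eq_sym e)))).
Qed.

Lemma pb2_pair (E : lccc) (X A B I : E) (f : Hom A I) (g : Hom B I)
  (h : Hom X A) (k : Hom X B) (e : f ∘ h = g ∘ k) :
  pb2 f g ∘ pb_pair e = k.
Proof.
exact (f_equal (fun u => shom u)
  (@pr2_pairing _ (cc_products (lslice I)) (SliceObj (f ∘ h)) _ _
     (@SliceHom _ _ (SliceObj (f ∘ h)) (SliceObj f) h eq_refl)
     (@SliceHom _ _ (SliceObj (f ∘ h)) (SliceObj g) k (eq_sym e)))).
Qed.

Lemma pb_unique (E : lccc) (X A B I : E) (f : Hom A I) (g : Hom B I)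
  (u v : Hom X (pb f g)) :
  pb1 f g ∘ u = pb1 f g ∘ v -> pb2 f g ∘ u = pb2 f g ∘ v -> u = v.
Proof.
intros e1 e2.
assert (ev : smap (pb_slice f g) ∘ v = smap (pb_slice f g) ∘ u).
{ assert (e0 : f ∘ pb1 f g = smap (pb_slice f g)).
  { exact (shomP (pr1 (cc_products (lslice I)) (SliceObj f) (SliceObj g))). }
  now rewrite <- e0, <- !compCA, e1. }
pose (x := SliceObj (smap (pb_slice f g) ∘ u)).
pose (u' := @SliceHom _ _ x (pb_slice f g) u eq_refl).
pose (v' := @SliceHom _ _ x (pb_slice f g) v ev).
assert (e : u' = v').
{ apply (@pairing_unique _ (cc_products (lslice I)) x (SliceObj f)
           (SliceObj g) u' v'); apply slice_hom_eq; assumption. }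
exact (f_equal (fun w => shom w) e).
Qed.

Lemma lterm_eq (E : lccc) (A : E) (f g : Hom A (tobj (lterminal E))) : f = g.
Proof.
now rewrite (tmap_unique (t := lterminal E) f),
  (tmap_unique (t := lterminal E) g).
Qed.

Definition lproducts (E : lccc) : products E.
Proof.
refine (@Products E
  (fun A B => pb (tmap (lterminal E) A) (tmap (lterminal E) B))
  (fun A B => pb1 (tmap (lterminal E) A) (tmap (lterminal E) B))
  (fun A B => pb2 (tmap (lterminal E) A) (tmap (lterminal E) B))
  (fun X A B h k => pb_pair (lterm_eq (tmap (lterminal E) A ∘ h)
                                      (tmap (lterminal E) B ∘ k)))
  _ _ _); intros.
- apply pb1_pair.
- apply pb2_pair.
- now apply pb_unique.
Defined.

Definition one (E : lccc) : E := tobj (lterminal E).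
Definition bang (E : lccc) (A : E) : Hom A (one E) := tmap (lterminal E) A.

Notation "A × B" := (prod_obj (lproducts _) A B)
  (at level 39, left associativity).
Notation "f ⊗ g" := (prod_map (lproducts _) f g)
  (at level 39, left associativity).
Notation "⟨ f , g ⟩" := (pairing (lproducts _) f g).
Notation π1 := (pr1 (lproducts _) _ _).
Notation π2 := (pr2 (lproducts _) _ _).

(** * Monoids, in the language of generalized elements [a : U -> T] *)

Record monoid_object (E : lccc) := MonoidObject {
  time :> E;
  zero : Hom (one E) time;
  plus : Hom (time × time) time;
  zero_plus : forall (U : E) (a : Hom U time),
    plus ∘ ⟨zero ∘ bang U, a⟩ = a;
  plus_zero : forall (U : E) (a : Hom U time),
    plus ∘ ⟨a, zero ∘ bang U⟩ = a;
  plus_assoc : forall (U : E) (a b c : Hom U time),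
    plus ∘ ⟨a, plus ∘ ⟨b, c⟩⟩ = plus ∘ ⟨plus ∘ ⟨a, b⟩, c⟩
}.

(** * Polynomials and their sections *)

(** The bundle [ptotal -> pos] stands for [sum_(i : p(1)) p[i] -> p(1)]. *)
Record polynomial (E : lccc) := Polynomial {
  pos : E;
  ptotal : E;
  bundle : Hom ptotal pos
}.

Record section (E : lccc) (p : polynomial E) := Section_ {
  sec : Hom (pos p) (ptotal p);
  secP : bundle p ∘ sec = idC (pos p)
}.

(** [fibres a] is [sum_(x : A) p[a x]], the pullback of the bundle along [a]. *)
Definition fibres (E : lccc) (p : polynomial E) (A : E) (a : Hom A (pos p)) : E :=
  pb a (bundle p).

Lemma pull_sectionP (E : lccc) (p : polynomial E) (A : E) (a : Hom A (pos p))
  (σ : section p) : a ∘ idC A = bundle p ∘ (sec σ ∘ a).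
Proof. now rewrite idCr, compCA, secP, idCl. Qed.

(** [a^* σ], that is, [x |-> (x, σ (a x))]. *)
Definition pull_section (E : lccc) (p : polynomial E) (A : E)
  (a : Hom A (pos p)) (σ : section p) : Hom A (fibres a) :=
  pb_pair (pull_sectionP a σ).

Lemma fibres_mapP (E : lccc) (p : polynomial E) (A A' : E)
  (a : Hom A (pos p)) (h : Hom A' A) :
  a ∘ (h ∘ pb1 (a ∘ h) (bundle p)) = bundle p ∘ pb2 (a ∘ h) (bundle p).
Proof. now rewrite compCA, pb_comm. Qed.

(** The canonical map [sum_(x' : A') p[a (h x')] -> sum_(x : A) p[a x]]. *)
Definition fibres_map (E : lccc) (p : polynomial E) (A A' : E)
  (a : Hom A (pos p)) (h : Hom A' A) : Hom (fibres (a ∘ h)) (fibres a) :=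
  pb_pair (fibres_mapP a h).

(** * Dynamical systems *)

(** For [t : U -> T], a map [U × S -> Z] is a [U]-indexed family of maps
    [S -> Z]; this is the family [θ(t)]. *)
Definition at_time (E : lccc) (T S Z U : E) (θ : Hom (T × S) Z) (t : Hom U T) :
  Hom (U × S) Z := θ ∘ (t ⊗ idC S).

(** [⟨π1, g⟩] runs [g] while remembering the stage, so [f ∘ ⟨π1, g⟩] is the
    composite of two [U]-indexed families, and [π2] is the identity family. *)
Record closed_system (E : lccc) (T : monoid_object E) (S : E)
  (θ : Hom (T × S) S) : Prop := ClosedSystem {
  closed_zero : forall U : E,
    at_time θ (zero T ∘ bang U) = π2;
  closed_plus : forall (U : E) (s t : Hom U T),
    at_time θ (plus T ∘ ⟨s, t⟩) = at_time θ s ∘ ⟨π1, at_time θ t⟩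
}.

(** The whole family [t |-> ϑ^σ(t)], as one map [T × S -> S]; see
    [closure_at_time]. *)
Definition closure (E : lccc) (T : monoid_object E) (p : polynomial E) (S : E)
  (o : Hom (T × S) (pos p)) (u : Hom (fibres o) S) (σ : section p) :
  Hom (T × S) S := u ∘ pull_section o σ.

Record open_system (E : lccc) (T : monoid_object E) (p : polynomial E) :=
  OpenSystem {
  state : E;
  output : Hom (T × state) (pos p);
  update : Hom (fibres output) state;
  open_closed : forall σ : section p, closed_system (closure update σ)
}.

Definition output_at (E : lccc) (T : monoid_object E) (p : polynomial E)
  (X : open_system T p) (U : E) (t : Hom U T) : Hom (U × state X) (pos p) :=
  at_time (output X) t.

Definition update_at (E : lccc) (T : monoid_object E) (p : polynomial E)
  (X : open_system T p) (U : E) (t : Hom U T) :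
  Hom (fibres (output_at X t)) (state X) :=
  update X ∘ fibres_map (output X) (t ⊗ idC (state X)).

Lemma closure_at_time (E : lccc) (T : monoid_object E) (p : polynomial E)
  (X : open_system T p) (σ : section p) (U : E) (t : Hom U T) :
  at_time (closure (update X) σ) t
  = update_at X t ∘ pull_section (output_at X t) σ.
Proof.
unfold at_time, closure, update_at; rewrite <- !compCA; apply f_equal.
unfold output_at, at_time, pull_section, fibres_map, fibres.
apply pb_unique; rewrite !compCA.
- transitivity (t ⊗ idC (state X)).
  + now rewrite (pb1_pair (pull_sectionP _ _)), idCl.
  + rewrite (pb1_pair (fibres_mapP _ _)), <- compCA.
    rewrite (pb1_pair (pull_sectionP (output X ∘ (t ⊗ idC (state X))) σ)).
    symmetry; apply idCr.
- rewrite (pb2_pair (pull_sectionP _ _)), (pb2_pair (fibres_mapP _ _)).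
  rewrite (pb2_pair (pull_sectionP (output X ∘ (t ⊗ idC (state X))) σ)).
  symmetry; apply compCA.
Qed.

(** * Morphisms of open dynamical systems *)

Record coalg_hom (E : lccc) (T : monoid_object E) (p : polynomial E)
  (X Y : open_system T p) := CoalgHom {
  hmap : Hom (state X) (state Y);
  hmapP : forall (U : E) (t : Hom U T) (σ : section p),
    hmap ∘ (update_at X t ∘ pull_section (output_at X t) σ)
    = (update_at Y t ∘ pull_section (output_at Y t) σ) ∘ (idC U ⊗ hmap)
}.

(* Main.v *)
From Stdlib Require Import ProofIrrelevance.
Require Import Defs.

Set Implicit Arguments.
Unset Strict Implicit.
Unset Printing Implicit Defensive.

(** At a time [t : U -> T], the closures of X and Y are maps [U × state X -> state X] and
    [U × state Y -> state Y], and being a morphism says that [hmap] makes a square between them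
    commute, with [idC U ⊗ hmap] on the source side. Since [U × -] is a functor ([prod_map_id],
    [prod_map_comp]), identity squares commute and squares paste. A morphism is determined by its
    underlying map ([coalg_hom_eq]), so the category laws are those of E. *)

Section ProdMap.

Variables (C : category) (P : products C).

Lemma prod_map_id (A B : C) :
  prod_map P (idC A) (idC B) = idC (prod_obj P A B).
Proof.
unfold prod_map; apply pairing_unique.
- now rewrite pr1_pairing, idCl, idCr.
- now rewrite pr2_pairing, idCl, idCr.
Qed.

Lemma prod_map_comp (A B A' B' A'' B'' : C)
  (f' : Hom A' A'') (g' : Hom B' B'') (f : Hom A A') (g : Hom B B') :
  prod_map P (f' ∘ f) (g' ∘ g) = prod_map P f' g' ∘ prod_map P f g.
Proof.
unfold prod_map; apply pairing_unique.
- now rewrite compCA, !pr1_pairing, <- !compCA, pr1_pairing.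
- now rewrite compCA, !pr2_pairing, <- !compCA, pr2_pairing.
Qed.

End ProdMap.

Section Coalgebras.

Variables (E : lccc) (T : monoid_object E) (p : polynomial E).
Implicit Types X Y Z : open_system T p.

Lemma coalg_hom_eq X Y (f g : coalg_hom X Y) : hmap f = hmap g -> f = g.
Proof.
destruct f as [f fP], g as [g gP]; simpl; intros e; subst g.
now rewrite (proof_irrelevance _ fP gP).
Qed.

Lemma coalg_idP X (U : E) (t : Hom U T) (σ : section p) :
  idC (state X) ∘ (update_at X t ∘ pull_section (output_at X t) σ)
  = (update_at X t ∘ pull_section (output_at X t) σ)
    ∘ (idC U ⊗ idC (state X)).
Proof. now rewrite prod_map_id, idCl, idCr. Qed.

(** Pastes the square of [f] to that of [g] along the closure of Y, with the same [t] and [σ]. *)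
Lemma coalg_compP X Y Z (g : coalg_hom Y Z) (f : coalg_hom X Y)
  (U : E) (t : Hom U T) (σ : section p) :
  hmap g ∘ hmap f ∘ (update_at X t ∘ pull_section (output_at X t) σ)
  = (update_at Z t ∘ pull_section (output_at Z t) σ)
    ∘ (idC U ⊗ (hmap g ∘ hmap f)).
Proof.
(* Writing [idC U] as [idC U ∘ idC U] lets the product map split into one factor per square. *)
rewrite <- (idCl (idC U)), prod_map_comp, <- (compCA (hmap g)), (hmapP f).
now rewrite (compCA (hmap g)), (hmapP g), compCA.
Qed.

(** Kept transparent so that the underlying maps of identities and composites are the expected ones
    by computation. *)
Definition coalg_category_on : category_on (@coalg_hom E T p).
Proof.
refine (@CategoryOn _ _ (fun X => CoalgHom (@coalg_idP X))
  (fun X Y Z g f => CoalgHom (coalg_compP g f)) _ _ _);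
  intros; apply coalg_hom_eq; simpl.
- apply idCl.
- apply idCr.
- apply compCA.
Defined.

End Coalgebras.

Theorem proposition2p3 (E : lccc) (T : monoid_object E) (p : polynomial E) :
  exists Coalg : category_on (@coalg_hom E T p),
    (forall X : open_system T p, hmap (idm Coalg X) = idC (state X)) /\
    (forall (X Y Z : open_system T p) (g : coalg_hom Y Z) (f : coalg_hom X Y),
       hmap (compm Coalg g f) = hmap g ∘ hmap f).
Proof. now exists (coalg_category_on T p). Qed.
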